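(* For every integer $n \geq 0$, \[ b_n(x) = \sum_{l=0}^n S_2(n,l)\, d_l(x). \] In particular, $b_n = \sum_{l=0}^n S_2(n,l)\, d_l$.
   Context: All generating functions are formal power series in $t$. The type 2 Bernoulli polynomials $b_n(x)$ are defined by $\frac{t}{e^t-e^{-t}}e^{xt} = \sum_{n\ge0} b_n(x)\frac{t^n}{n!}$, with $b_n=b_n(0)$. The type 2 Daehee polynomials $d_n(x)$ are defined by $\frac{\log(1+t)}{(1+t)-(1+t)^{-1}}(1+t)^x = \sum_{n\ge0} d_n(x)\frac{t^n}{n!}$, with $d_n = d_n(0)$. The Stirling numbers of the second kind $S_2(n,l)$ are defined by $\frac{1}{l!}(e^t-1)^l = \sum_{n\ge l} S_2(n,l)\frac{t^n}{n!}$. *)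

(* Defs.v *)
From HB Require Import structures.
From mathcomp Require Import all_boot all_order all_algebra.
From mathcomp Require Import boolp classical_sets.

Set Implicit Arguments.
Unset Strict Implicit.
Unset Printing Implicit Defensive.

Import GRing.Theory.
Local Open Scope ring_scope.

(* A record rather than nat -> R itself, whose canonical ring structure would
   be the pointwise one. *)
Record fps (R : Type) := Fps { fps_coef :> nat -> R }.

HB.instance Definition _ (R : Type) := gen_eqMixin (fps R).
HB.instance Definition _ (R : Type) := gen_choiceMixin (fps R).

Lemma fpsP (R : Type) (f g : fps R) : (forall n, f n = g n) -> f = g.
Proof. by case: f g => [f] [g] /= fg; congr Fps; apply/funext. Qed.

Section Zmodule.
Variable R : zmodType.
Implicit Types f g : fps R.

Definition fps0 : fps R := Fps (fun=> 0).
Definition fps_opp f : fps R := Fps (fun n => - f n).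
Definition fps_add f g : fps R := Fps (fun n => f n + g n).

Fact fps_addA : associative fps_add.
Proof. by move=> f g h; apply: fpsP => n /=; rewrite addrA. Qed.
Fact fps_addC : commutative fps_add.
Proof. by move=> f g; apply: fpsP => n /=; rewrite addrC. Qed.
Fact fps_add0 : left_id fps0 fps_add.
Proof. by move=> f; apply: fpsP => n /=; rewrite add0r. Qed.
Fact fps_addN : left_inverse fps0 fps_opp fps_add.
Proof. by move=> f; apply: fpsP => n /=; rewrite addNr. Qed.

HB.instance Definition _ :=
  GRing.isZmodule.Build (fps R) fps_addA fps_addC fps_add0 fps_addN.

End Zmodule.

Section Ring.
Variable R : comNzRingType.
Implicit Types f g h : fps R.

Definition fpsC (c : R) : fps R := Fps (fun n => if n == 0%N then c else 0).
Definition fps_mul f g : fps R := Fps (fun n => \sum_(i < n.+1) f i * g (n - i)%N).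

Definition fps_trunc m f : {poly R} := \poly_(i < m) f i.

Lemma fps_mul_trunc m f g n : (n < m)%N ->
  fps_mul f g n = (fps_trunc m f * fps_trunc m g)`_n.
Proof.
move=> nm; rewrite coefM /=; apply: eq_bigr => i _.
have im : (i < m)%N by apply: leq_ltn_trans nm; rewrite -ltnS.
by rewrite !coef_poly im (leq_ltn_trans (leq_subr i n) nm).
Qed.

Fact fps_mulC : commutative fps_mul.
Proof.
by move=> f g; apply: fpsP => n; rewrite !(@fps_mul_trunc n.+1) // mulrC.
Qed.

Lemma fps_mul3 f g h n : fps_mul (fps_mul f g) h n =
  (fps_trunc n.+1 f * fps_trunc n.+1 g * fps_trunc n.+1 h)`_n.
Proof.
rewrite coefM /=; apply: eq_bigr => i _.
rewrite -[X in X * _]/(fps_mul f g i) (@fps_mul_trunc n.+1) //.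
by rewrite [in RHS](coef_poly _ _ (n - i)) ltnS leq_subr.
Qed.

Fact fps_mulA : associative fps_mul.
Proof.
move=> f g h; apply: fpsP => n; rewrite fps_mulC !fps_mul3.
by rewrite mulrC mulrA.
Qed.

Fact fps_mul1 : left_id (fpsC 1) fps_mul.
Proof.
move=> f; apply: fpsP => n /=; rewrite big_ord_recl /= subn0 mul1r big1 ?addr0//.
by move=> i _; rewrite mul0r.
Qed.

Fact fps_mulDl : left_distributive fps_mul (@fps_add R).
Proof.
move=> f g h; apply: fpsP => n /=; rewrite -big_split /=.
by apply: eq_bigr => i _; rewrite mulrDl.
Qed.

Fact fps_oner_neq0 : fpsC 1 != 0.
Proof.
apply/eqP => /(congr1 (fun f : fps R => f 0%N)) /eqP; exact/negP/oner_neq0.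
Qed.

HB.instance Definition _ := GRing.Zmodule_isComNzRing.Build (fps R)
  fps_mulA fps_mulC fps_mul1 fps_mulDl fps_oner_neq0.

Lemma coef_fpsM f g n : (f * g) n = \sum_(i < n.+1) f i * g (n - i)%N.
Proof. by []. Qed.

Lemma coef_fpsM0 f g : (f * g) 0%N = f 0%N * g 0%N.
Proof. by rewrite coef_fpsM big_ord1. Qed.

Lemma coef_fpsD f g n : (f + g) n = f n + g n.
Proof. by []. Qed.

Lemma coef_fpsB f g n : (f - g) n = f n - g n.
Proof. by []. Qed.

Lemma coef_fps1 n : (1 : fps R) n = (n == 0%N)%:R.
Proof. by rewrite /GRing.one /=; case: eqP. Qed.

End Ring.

Section UnitRing.
Variable R : comUnitRingType.
Implicit Types f g : fps R.

Definition fps_unit : {pred fps R} := fun f => f 0%N \is a GRing.unit.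

Fixpoint fps_inv_seq f n : seq R :=
  if n is m.+1 then
    let s := fps_inv_seq f m in
    rcons s (if m is 0 then (f 0%N)^-1
             else - (f 0%N)^-1 * \sum_(i < m) s`_i * f (m - i)%N)
  else [::].

Definition fps_inv f : fps R :=
  if fps_unit f then Fps (fun n => (fps_inv_seq f n.+1)`_n) else f.

Lemma size_fps_inv_seq f n : size (fps_inv_seq f n) = n.
Proof. by elim: n => //= n IH; rewrite size_rcons IH. Qed.

Lemma nth_fps_inv_seq f m n : (n < m)%N ->
  (fps_inv_seq f m)`_n = (fps_inv_seq f n.+1)`_n.
Proof.
elim: m => // m IH; rewrite ltnS leq_eqVlt => /predU1P[->//|nm].
by rewrite [fps_inv_seq f m.+1]/= nth_rcons size_fps_inv_seq nm IH.
Qed.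

Lemma nth_fps_inv_seqS f n : (fps_inv_seq f n.+2)`_n.+1 =
  - (f 0%N)^-1 * \sum_(i < n.+1) (fps_inv_seq f i.+1)`_i * f (n.+1 - i)%N.
Proof.
rewrite -[fps_inv_seq f n.+2]/(rcons (fps_inv_seq f n.+1) _).
rewrite nth_rcons size_fps_inv_seq ltnn eqxx; congr (_ * _).
by apply: eq_bigr => i _; rewrite (nth_fps_inv_seq f (ltn_ord i)).
Qed.

Let fps_coefK (u : nat -> R) n : Fps u n = u n. Proof. by []. Qed.

Fact fps_mulVr : {in fps_unit, left_inverse 1 fps_inv *%R}.
Proof.
move=> f uf; have {}uf : f 0%N \is a GRing.unit by [].
rewrite /fps_inv /fps_unit uf.
apply: fpsP => -[|n]; first by rewrite coef_fpsM0 coef_fps1 /= mulVr.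
rewrite coef_fps1 coef_fpsM big_ord_recr subnn fps_coefK nth_fps_inv_seqS.
rewrite mulrAC mulNr mulVr // mulN1r; apply/eqP; rewrite subr_eq0.
by apply/eqP/eq_bigr => i _; rewrite fps_coefK.
Qed.

Fact fps_unitPl f g : g * f = 1 -> fps_unit f.
Proof.
move=> /(congr1 (fun h : fps R => h 0%N)); rewrite coef_fpsM0 coef_fps1 /= => gf.
by apply/unitrPr; exists (g 0%N); rewrite mulrC.
Qed.

Fact fps_inv_out : {in [predC fps_unit], fps_inv =1 id}.
Proof. by move=> f fN; rewrite /fps_inv ifN. Qed.

HB.instance Definition _ := GRing.ComNzRing_hasMulInverse.Build (fps R)
  fps_mulVr fps_unitPl fps_inv_out.

Lemma fps_unitE f : (f \is a GRing.unit) = (f 0%N \is a GRing.unit).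
Proof. by []. Qed.

End UnitRing.

Section IntegralDomain.
Variable R : idomainType.
Implicit Types f g h : fps R.

Lemma fps_order f : f != 0 -> exists2 n, f n != 0 & forall i, (i < n)%N -> f i = 0.
Proof.
move=> f0; have exf : exists n, f n != 0.
  apply: contrapT => nf; move/eqP: f0; apply; apply: fpsP => n.
  by apply/eqP; apply: contrapT => /negP fn; apply: nf; exists n.
case: (ex_minnP exf) => n fn minn; exists n => // i lt_in.
by apply/eqP; apply: contraTT lt_in => /minn; rewrite -leqNgt.
Qed.

Fact fps_integral f g : f * g = 0 -> (f == 0) || (g == 0).
Proof.
apply: contra_eqT; rewrite negb_or => /andP[/fps_order[m fm f0] /fps_order[k gk g0]].
apply/eqP => /(congr1 (fun h : fps R => h (m + k)%N)); rewrite coef_fpsM.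
have mlt : (m < (m + k).+1)%N by rewrite ltnS leq_addr.
rewrite (bigD1 (Ordinal mlt)) //= addKn big1 ?addr0 => [|i].
  by move/eqP; rewrite mulf_eq0 (negPf fm) (negPf gk).
rewrite -val_eqE /= neq_ltn => /orP[/f0->|lt_mi]; first by rewrite mul0r.
rewrite g0 ?mulr0 // ltn_subLR ?ltn_add2r //; by rewrite -ltnS.
Qed.

HB.instance Definition _ :=
  GRing.ComUnitRing_isIntegral.Build (fps R) fps_integral.

(* Exact quotient: the h with h * g = f, unique when g != 0, and 0 if g does
   not divide f.  The ring operation f / g is not the quotient when g has zero
   constant term, g being then not invertible. *)
Definition fps_quot f g : fps R := xget 0 [set h | h * g = f].

Lemma fps_quotK f g h : g != 0 -> h * g = f -> fps_quot f g = h.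
Proof.
move=> g0 hgf; apply: (mulIf g0); rewrite hgf.
by apply: (xgetPex 0 (P := [set h | h * g = f])); exists h.
Qed.

End IntegralDomain.

Section Series.
Variable R : comUnitRingType.

Definition fpsT : fps R := Fps (fun n => (n == 1%N)%:R).

Definition fps_exp (a : R) : fps R := Fps (fun n => a ^+ n / n`!%:R).

Definition fps_log1p : fps R :=
  Fps (fun n => if n is m.+1 then (-1) ^+ m / n%:R else 0).

(* (1 + t)^a, the binomial series. *)
Definition fps_pow1p (a : R) : fps R :=
  Fps (fun n => (\prod_(i < n) (a - i%:R)) / n`!%:R).

Definition fps_egf (u : nat -> R) : fps R := Fps (fun n => u n / n`!%:R).

Definition egf_coef (f : fps R) (n : nat) : R := n`!%:R * f n.

End Series.

Arguments fpsT {R}.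
Arguments fps_log1p {R}.

Section Families.
Variable F : fieldType.

(* The variable x of the families is 'X : {poly F}; the generating functions
   are power series in t over {poly F}. *)
Definition bernoulli2_gf : fps {poly F} :=
  fps_quot fpsT (fps_exp 1 - fps_exp (-1)) * fps_exp 'X.

Definition bernoulli2_poly (n : nat) : {poly F} := egf_coef bernoulli2_gf n.

Definition bernoulli2 (n : nat) : F := (bernoulli2_poly n).[0].

Definition daehee2_gf : fps {poly F} :=
  fps_quot fps_log1p ((1 + fpsT) - (1 + fpsT)^-1) * fps_pow1p 'X.

Definition daehee2_poly (n : nat) : {poly F} := egf_coef daehee2_gf n.

Definition daehee2 (n : nat) : F := (daehee2_poly n).[0].

Definition stirling2 (n l : nat) : F :=
  egf_coef ((fps_exp 1 - 1) ^+ l / l`!%:R) n.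

End Families.

(* In characteristic 0 the two quotients are exact, and each family has its
   generating function as exponential generating function. *)
Section WellDefined.
Variable F : fieldType.
Hypothesis charF0 : [pchar F] =i pred0.

Lemma fact_polyF_unit n : (n`!%:R : {poly F}) \is a GRing.unit.
Proof.
have n0 : n`!%:R != 0 :> F by rewrite ((pcharf0P F).1 charF0) -lt0n fact_gt0.
by rewrite -polyC_natr poly_unitE coefC eqxx size_polyC unitfE n0.
Qed.

Lemma fps_egfK (f : fps {poly F}) : fps_egf (egf_coef f) = f.
Proof.
by apply: fpsP => n /=; rewrite /egf_coef mulrAC divrr ?mul1r ?fact_polyF_unit.
Qed.

Lemma fps_quot_order1 (f g : fps {poly F}) :
  f 0%N = 0 -> g 0%N = 0 -> g 1%N \is a GRing.unit -> fps_quot f g * g = f.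
Proof.
have shiftE (h : fps {poly F}) : h 0%N = 0 -> h = fpsT * Fps (fun n => h n.+1).
  move=> h0; apply: fpsP => -[|n]; rewrite ?coef_fpsM0 ?mul0r // coef_fpsM.
  rewrite big_ord_recl mul0r add0r big_ord_recl /= subn1 mul1r.
  by rewrite big1 ?addr0 // => i _; rewrite mul0r.
move=> f0 g0 g1; have g_neq0 : g != 0.
  by apply: contraTneq g1 => -> /=; rewrite unitr0.
rewrite (@fps_quotK _ _ _ (Fps (fun n => f n.+1) / Fps (fun n => g n.+1))) //.
  rewrite {2}(shiftE g g0) mulrCA mulrVK ?fps_unitE //.
  by rewrite -shiftE.
rewrite {2}(shiftE g g0) mulrCA mulrVK ?fps_unitE //.
by rewrite -shiftE.
Qed.

Lemma two_polyF_unit : (1 + 1 : {poly F}) \is a GRing.unit.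
Proof. by have := fact_polyF_unit 2; rewrite -[_%:R]/(1 + 1). Qed.

Lemma bernoulli2_quotK :
  fps_quot fpsT (fps_exp 1 - fps_exp (-1)) * (fps_exp 1 - fps_exp (-1))
  = fpsT :> fps {poly F}.
Proof.
apply: fps_quot_order1; rewrite ?coef_fpsB //= ?subrr //.
by rewrite !expr1 divr1 divr1 opprK two_polyF_unit.
Qed.

Lemma bernoulli2_egf : fps_egf (@bernoulli2_poly F) = bernoulli2_gf F.
Proof. exact: fps_egfK. Qed.

Lemma daehee2_quotK :
  fps_quot fps_log1p ((1 + fpsT) - (1 + fpsT)^-1) *
    ((1 + fpsT) - (1 + fpsT)^-1) = fps_log1p :> fps {poly F}.
Proof.
have u1T : (1 + fpsT : fps {poly F}) \is a GRing.unit.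
  by rewrite fps_unitE coef_fpsD coef_fps1 addr0 unitr1.
have inv0 : ((1 + fpsT : fps {poly F})^-1) 0%N = 1.
  have /(congr1 (fun h : fps _ => h 0%N)) := mulVr u1T.
  by rewrite coef_fpsM0 coef_fpsD !coef_fps1 /= addr0 mulr1.
have inv1 : ((1 + fpsT : fps {poly F})^-1) 1%N = -1.
  have /(congr1 (fun h : fps _ => h 1%N)) := mulVr u1T.
  rewrite coef_fpsM big_ord_recl big_ord1 subn0 subnn !coef_fpsD !coef_fps1 inv0.
  rewrite /= addr0 add0r !mulr1 => /eqP.
  by rewrite addrC addr_eq0 => /eqP.
apply: fps_quot_order1 => //; rewrite coef_fpsB coef_fpsD coef_fps1.
  by rewrite inv0 addr0 subrr.
by rewrite inv1 add0r opprK two_polyF_unit.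
Qed.

Lemma daehee2_egf : fps_egf (@daehee2_poly F) = daehee2_gf F.
Proof. exact: fps_egfK. Qed.

End WellDefined.

(* Main.v *)
(** Substituting [e^t - 1] for [t] is a ring endomorphism of the power series
    in [t] sending [1 + t] to [e^t], [log (1 + t)] to [t] and [(1 + t)^x] to
    [e^(x t)], hence the generating function of the [d_l(x)] to that of the
    [b_n(x)].  Reading off the coefficient of [t^n] in
    [sum_l d_l(x) (e^t - 1)^l / l!] gives the formula.  The last two images are
    found by differentiation: the chain rule shows that both sides satisfy the same
    first order linear differential equation. *)
From HB Require Import structures.
Require Import Defs.
From mathcomp Require Import all_boot all_order all_algebra.
From mathcomp Require Import ring.

Set Implicit Arguments.
Unset Strict Implicit.
Unset Printing Implicit Defensive.

Import GRing.Theory.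
Local Open Scope ring_scope.

(** * Change of coefficient ring, used to pass from [F] to [{poly F}] *)

Section Map.
Variables (R S : comNzRingType) (phi : {rmorphism R -> S}).

Definition fps_map (f : fps R) : fps S := Fps (fun n => phi (f n)).

Lemma fps_mapM f g : fps_map (f * g) = fps_map f * fps_map g.
Proof.
apply: fpsP => n; rewrite coef_fpsM /= rmorph_sum.
by apply: eq_bigr => i _; rewrite rmorphM.
Qed.

Lemma fps_map1 : fps_map 1 = 1.
Proof.
by apply: fpsP => n; rewrite coef_fps1 /= fun_if rmorph1 rmorph0; case: eqP.
Qed.

Lemma fps_mapB f g : fps_map (f - g) = fps_map f - fps_map g.
Proof. by apply: fpsP => n /=; rewrite rmorphB. Qed.

Lemma fps_mapX f k : fps_map (f ^+ k) = fps_map f ^+ k.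
Proof. by elim: k => [|k IH]; rewrite ?fps_map1 // !exprS fps_mapM IH. Qed.

End Map.

(** * Formal differentiation *)

Section Derivation.
Variable R : comNzRingType.
Implicit Types f g h : fps R.

Definition fps_deriv f : fps R := Fps (fun n => n.+1%:R * f n.+1).

Lemma fps_derivB f g : fps_deriv (f - g) = fps_deriv f - fps_deriv g.
Proof. by apply: fpsP => n /=; rewrite mulrBr. Qed.

Lemma fps_deriv1 : fps_deriv 1 = 0.
Proof. by apply: fpsP => n; rewrite /= mulr0. Qed.

(** Transferred from polynomials: a coefficient of a product sees only truncations of the factors.
    Differentiation costs one order, hence truncation at [n.+2] before it and at [n.+1] after. *)
Lemma fps_derivM f g : fps_deriv (f * g) = fps_deriv f * g + f * fps_deriv g.
Proof.
have dE h n : fps_trunc n.+1 (fps_deriv h) = (fps_trunc n.+2 h)^`().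
  apply/polyP => i; rewrite coef_deriv !coef_poly [(i.+1 < _)%N]ltnS /=.
  by case: ifP => _; rewrite ?mul0rn ?mulr_natl.
have mE h1 h2 m n : (n < m)%N ->
    (h1 * h2) n = (fps_trunc m h1 * fps_trunc m h2)`_n.
  exact: fps_mul_trunc.
apply: fpsP => n; rewrite coef_fpsD -[LHS]/(n.+1%:R * (f * g) n.+1).
rewrite (mE f g n.+2) // mulr_natl.
rewrite -coef_deriv derivM coefD -!dE.
have tE h i : (i < n.+1)%N -> (fps_trunc n.+2 h)`_i = (fps_trunc n.+1 h)`_i.
  by move=> lt_in; rewrite !coef_poly lt_in ltnW.
congr (_ + _); rewrite (mE _ _ n.+1) // !coefM; apply: eq_bigr => i _.
  by rewrite (tE g) // ltnS leq_subr.
by rewrite (tE f).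
Qed.

Lemma fps_derivXS f k : fps_deriv (f ^+ k.+1) = k.+1%:R * (f ^+ k * fps_deriv f).
Proof.
elim: k => [|k IH]; first by rewrite expr1 expr0 !mul1r.
by rewrite exprS fps_derivM IH !exprS [k.+2%:R]mulrS; ring.
Qed.

End Derivation.

(** * The embedding of constants *)

Section Constants.
Variable R : comNzRingType.

Fact fpsC_is_zmod_morphism : zmod_morphism (@fpsC R).
Proof. by move=> a b; apply: fpsP => -[|n] //=; rewrite subr0. Qed.

Lemma coef_fpsCM (a : R) f n : (fpsC a * f) n = a * f n.
Proof.
rewrite coef_fpsM big_ord_recl subn0 /= big1 ?addr0 // => i _.
by rewrite mul0r.
Qed.

Fact fpsC_is_monoid_morphism : monoid_morphism (@fpsC R).
Proof.
split=> // a b; apply: fpsP => n; rewrite coef_fpsCM /=.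
by case: eqP; rewrite ?mulr0.
Qed.

HB.instance Definition _ :=
  GRing.isZmodMorphism.Build R (fps R) (@fpsC R) fpsC_is_zmod_morphism.
HB.instance Definition _ :=
  GRing.isMonoidMorphism.Build R (fps R) (@fpsC R) fpsC_is_monoid_morphism.

Lemma fps_sumE I (r : seq I) (P : pred I) (f : I -> fps R) n :
  (\sum_(i <- r | P i) f i) n = \sum_(i <- r | P i) f i n.
Proof. by apply: (big_morph (fun h : fps R => h n)). Qed.

End Constants.

(** * Composition of power series *)

Section Composition.
Variable R : comNzRingType.
Implicit Types f g h : fps R.

(* This is f(g(t)) only when g has zero constant term. *)
Definition fps_comp f g : fps R :=
  Fps (fun n => \sum_(k < n.+1) f k * (g ^+ k) n).

Lemma coef_fps_comp f g n : fps_comp f g n = \sum_(k < n.+1) f k * (g ^+ k) n.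
Proof. by []. Qed.

(** Since [t] divides [g], [t^k] divides [g^k]; this makes the cut-off in [fps_comp] harmless. *)
Lemma coef_fpsXn_lt g k n : g 0%N = 0 -> (n < k)%N -> (g ^+ k) n = 0.
Proof.
move=> g0; elim: k n => // k IH n; rewrite ltnS => le_nk.
rewrite exprS coef_fpsM big_ord_recl g0 mul0r add0r big1 // => i _.
rewrite IH ?mulr0 //; have lt_in := ltn_ord i.
by rewrite (leq_trans _ le_nk) // ltn_subrL (leq_ltn_trans _ lt_in).
Qed.

Lemma fps_comp_widen f g m n : g 0%N = 0 -> (n < m)%N ->
  fps_comp f g n = \sum_(k < m) f k * (g ^+ k) n.
Proof.
move=> g0 lt_nm; rewrite /= (big_ord_widen m (fun k => f k * (g ^+ k) n)) //.
rewrite big_mkcond; apply: eq_bigr => k _; case: ltnP => // lt_nk.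
by rewrite coef_fpsXn_lt ?mulr0.
Qed.

Lemma fps_compD f h g : fps_comp (f + h) g = fps_comp f g + fps_comp h g.
Proof.
apply: fpsP => n; rewrite coef_fpsD /= -big_split.
by apply: eq_bigr => k _; rewrite mulrDl.
Qed.

Lemma fps_compB f h g : fps_comp (f - h) g = fps_comp f g - fps_comp h g.
Proof.
apply: fpsP => n; rewrite coef_fpsB /= -sumrB.
by apply: eq_bigr => k _; rewrite mulrBl.
Qed.

Lemma coef_fps_comp0 f g : fps_comp f g 0%N = f 0%N.
Proof. by rewrite /= big_ord1 expr0 mulr1. Qed.

Lemma fps_comp1 g : fps_comp 1 g = 1.
Proof.
apply: fpsP => n; rewrite coef_fps_comp big_ord_recl coef_fps1 mul1r expr0.
by rewrite big1 ?addr0 // => k _; rewrite coef_fps1 mul0r.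
Qed.

Lemma fps_comp_fpsC c g : fps_comp (fpsC c) g = fpsC c.
Proof.
apply: fpsP => n; rewrite coef_fps_comp big_ord_recl expr0 coef_fps1 big1 ?addr0 /=.
  by case: eqP; rewrite ?mulr1 ?mulr0.
by move=> k _; rewrite mul0r.
Qed.

Lemma coef_horner_fps (p : {poly R}) g m n : g 0%N = 0 -> (n < m)%N ->
  (map_poly (@fpsC R) p).[g] n = \sum_(k < m) p`_k * (g ^+ k) n.
Proof.
(* A bound covering both sums; the terms of index at least [m] vanish at order [n]. *)
move=> g0 lt_nm; rewrite (@horner_coef_wide _ (maxn m (size p))); last first.
  by rewrite (leq_trans (size_poly _ _)) ?leq_maxr.
rewrite fps_sumE.
rewrite (big_ord_widen _ (fun k => p`_k * (g ^+ k) n) (leq_maxl m (size p))).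
rewrite [RHS]big_mkcond; apply: eq_bigr => k _; rewrite coef_map coef_fpsCM.
by case: ltnP => // le_mk; rewrite coef_fpsXn_lt ?mulr0 ?(leq_trans lt_nm).
Qed.

Lemma coef_fps_comp_trunc f g m n : g 0%N = 0 -> (n < m)%N ->
  fps_comp f g n = (map_poly (@fpsC R) (fps_trunc m f)).[g] n.
Proof.
move=> g0 lt_nm; rewrite (fps_comp_widen _ g0 lt_nm) (coef_horner_fps _ g0 lt_nm).
by apply: eq_bigr => k _; rewrite coef_poly ltn_ord.
Qed.

(* Modulo [t^m] only the truncations of [f] and [h] at order [m] matter, and
   for polynomials the claim is that evaluation at [g] is multiplicative. *)
Lemma fps_compM f h g : g 0%N = 0 ->
  fps_comp (f * h) g = fps_comp f g * fps_comp h g.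
Proof.
move=> g0; apply: fpsP => n; rewrite coef_fpsM.
have le_in (i : 'I_n.+1) : (i <= n)%N by rewrite -ltnS.
under eq_bigr => i _ do rewrite !(@coef_fps_comp_trunc _ _ n.+1) ?ltnS ?leq_subr //.
rewrite -coef_fpsM -hornerM -rmorphM (@coef_horner_fps _ _ n.+1) //.
by apply: eq_bigr => k _; rewrite (@fps_mul_trunc _ n.+1).
Qed.

(** By linearity in [f] the chain rule reduces to the derivative of each power [g^(k+1)]. *)
Lemma fps_deriv_comp f g : g 0%N = 0 ->
  fps_deriv (fps_comp f g) = fps_comp (fps_deriv f) g * fps_deriv g.
Proof.
move=> g0; apply: fpsP => n; rewrite coef_fpsM.
rewrite -[LHS]/(n.+1%:R * fps_comp f g n.+1) coef_fps_comp mulr_sumr.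
rewrite big_ord_recl expr0 coef_fps1 !mulr0 add0r.
have le_in (i : 'I_n.+1) : (i < n.+1)%N by [].
(* A summation range independent of [i] allows the two sums to be exchanged. *)
under [RHS]eq_bigr => i _ do
  rewrite (@fps_comp_widen _ _ n.+1) // mulr_suml.
rewrite exchange_big; apply: eq_bigr => k _.
under eq_bigr => i _ do rewrite -mulrA.
rewrite -mulr_sumr -coef_fpsM [LHS]mulrCA.
rewrite -[_ * (g ^+ _) _]/(fps_deriv (g ^+ k.+1) n).
by rewrite fps_derivXS -(rmorph_nat (@fpsC R)) coef_fpsCM mulrA [f _ * _]mulrC.
Qed.

End Composition.

Section UnitComposition.
Variable R : comUnitRingType.
Implicit Types f g h : fps R.

Lemma fps_compT g : g 0%N = 0 -> fps_comp fpsT g = g.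
Proof.
(* The bound [n.+2] keeps the term of index 1 even for [n = 0]. *)
move=> g0; apply: fpsP => n; rewrite (@fps_comp_widen _ _ _ n.+2 n) //.
rewrite !big_ord_recl /= mul0r add0r mul1r big1 ?addr0 // => k _.
by rewrite mul0r.
Qed.

End UnitComposition.

(** * Exponential, logarithm and binomial series under [t -> e^t - 1] *)

Section Series.
Variable R : comUnitRingType.
Hypothesis natU : forall n, n.+1%:R \is a @GRing.unit R.
Implicit Types (f g : fps R) (a : R).

Lemma factU n : n`!%:R \is a @GRing.unit R.
Proof. by case: (n`!) (fact_gt0 n). Qed.

Lemma divr_factS (x : R) n : n.+1%:R * (x / n.+1`!%:R) = x / n`!%:R.
Proof. by rewrite factS natrM invrM ?factU // mulrC -!mulrA mulVr ?mulr1. Qed.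

Lemma fps_deriv_inj f g : f 0%N = g 0%N -> fps_deriv f = fps_deriv g -> f = g.
Proof.
move=> fg0 dfg; apply: fpsP => -[|n] //.
by apply: (mulrI (natU n)); apply: (congr1 (fun h : fps R => h n) dfg).
Qed.

Lemma fps_deriv_exp a : fps_deriv (fps_exp a) = fpsC a * fps_exp a.
Proof. by apply: fpsP => n; rewrite coef_fpsCM /= divr_factS exprS mulrA. Qed.

(** The equation is the recurrence [(n+1) y_(n+1) = a y_n], in which [n+1] is invertible. *)
Lemma fps_deriv_linear_uniq a f g : f 0%N = g 0%N ->
  fps_deriv f = fpsC a * f -> fps_deriv g = fpsC a * g -> f = g.
Proof.
move=> fg0 df dg; apply: fpsP; elim=> // n IH; apply: (mulrI (natU n)).
rewrite -[LHS]/(fps_deriv f n) -[RHS]/(fps_deriv g n) df dg.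
by rewrite !coef_fpsCM IH.
Qed.

Lemma fps_expN a : fps_exp a * fps_exp (- a) = 1.
Proof.
apply: fps_deriv_inj; first by rewrite coef_fpsM0 /= !expr0 divr1 mulr1.
by rewrite fps_derivM !fps_deriv_exp fps_deriv1 rmorphN; ring.
Qed.

Lemma fps_derivT : fps_deriv fpsT = 1 :> fps R.
Proof. by apply: fpsP => -[|n]; rewrite coef_fps1 /= ?mulr1 ?mulr0. Qed.

Lemma fps_1DT_unit : (1 + fpsT : fps R) \is a GRing.unit.
Proof. by rewrite fps_unitE coef_fpsD coef_fps1 addr0 unitr1. Qed.

Lemma coef_fps_1DTM f n : ((1 + fpsT) * f) n.+1 = f n.+1 + f n.
Proof.
rewrite mulrDl mul1r coef_fpsD; congr (_ + _).
rewrite coef_fpsM !big_ord_recl /= mul0r add0r mul1r subn1 big1 ?addr0 // => i _.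
by rewrite mul0r.
Qed.

Lemma fps_deriv_log1p : (1 + fpsT) * fps_deriv fps_log1p = 1 :> fps R.
Proof.
apply: fpsP => -[|n].
  by rewrite coef_fpsM0 coef_fpsD !coef_fps1 /= addr0 expr0 !mul1r invr1.
by rewrite coef_fps_1DTM coef_fps1 /= ![_.+1%:R * _]mulrC !divrK // exprS; ring.
Qed.

Lemma fps_deriv_pow1p a :
  (1 + fpsT) * fps_deriv (fps_pow1p a) = fpsC a * fps_pow1p a.
Proof.
apply: fpsP => -[|n]; rewrite coef_fpsCM.
  rewrite coef_fpsM0 coef_fpsD coef_fps1 /= big_ord1 big_ord0.
  by rewrite addr0 !divr1 subr0 !mul1r mulr1.
rewrite coef_fps_1DTM /= !divr_factS [in X in X + _]big_ord_recr /=.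
(* Over the common denominator [(n+1)!] the claim is [(a - (n+1)) + (n+1) = a]. *)
set P := \prod_(i < _) _; rewrite -[X in _ + X]divr_factS; ring.
Qed.

Definition fps_expm1 : fps R := fps_exp 1 - 1.

Lemma fps_expm1_0 : fps_expm1 0%N = 0.
Proof. by rewrite coef_fpsB coef_fps1 /= expr0 divr1 subrr. Qed.
Hint Resolve fps_expm1_0 : core.

Lemma fps_comp_1DT : fps_comp (1 + fpsT) fps_expm1 = fps_exp 1.
Proof. by rewrite fps_compD fps_comp1 fps_compT // addrC subrK. Qed.

Lemma fps_comp_1DTV : fps_comp (1 + fpsT)^-1 fps_expm1 = fps_exp (-1).
Proof.
have expU : fps_exp 1 \is a @GRing.unit (fps R).
  by apply/unitrPr; exists (fps_exp (-1)); rewrite fps_expN.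
apply: (mulrI expU).
by rewrite fps_expN -{1}fps_comp_1DT -fps_compM // divrr ?fps_comp1 ?fps_1DT_unit.
Qed.

Lemma fps_deriv_expm1 : fps_deriv fps_expm1 = fps_exp 1.
Proof. by rewrite fps_derivB fps_deriv1 subr0 fps_deriv_exp mul1r. Qed.

Lemma fps_comp_log1p : fps_comp fps_log1p fps_expm1 = fpsT.
Proof.
apply: fps_deriv_inj; first by rewrite coef_fps_comp0.
(* The chain rule factor [e^t] is itself the image of [1 + t], so it merges with the image of the
   derivative. *)
rewrite fps_deriv_comp // fps_deriv_expm1 -fps_comp_1DT -fps_compM //.
by rewrite mulrC fps_deriv_log1p fps_comp1 fps_derivT.
Qed.

Lemma fps_comp_pow1p a : fps_comp (fps_pow1p a) fps_expm1 = fps_exp a.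
Proof.
apply: (@fps_deriv_linear_uniq a); last exact: fps_deriv_exp.
  by rewrite coef_fps_comp0 /= big_ord0 expr0.
rewrite fps_deriv_comp // fps_deriv_expm1 -fps_comp_1DT -fps_compM //.
by rewrite mulrC fps_deriv_pow1p fps_compM // fps_comp_fpsC.
Qed.

End Series.

(** * Bernoulli and Daehee polynomials and Stirling numbers *)

Section Families.
Variable F : fieldType.
Hypothesis charF0 : [pchar F] =i pred0.

Lemma natr_polyF_unit n : n.+1%:R \is a @GRing.unit {poly F}.
Proof.
have n0 : n.+1%:R != 0 :> F by rewrite ((pcharf0P F).1 charF0).
by rewrite -polyC_natr poly_unitE coefC eqxx size_polyC unitfE n0.
Qed.

Lemma daehee2_gf_comp : fps_comp (daehee2_gf F) (fps_expm1 _) = bernoulli2_gf F.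
Proof.
have natU := natr_polyF_unit; have u0 := fps_expm1_0 {poly F}.
rewrite /daehee2_gf fps_compM // fps_comp_pow1p //; congr (_ * _).
apply/esym/fps_quotK.
  (* Were the denominator zero, [bernoulli2_quotK] would give [fpsT = 0], false at coefficient 1. *)
  apply/eqP => /(congr1 (fun h : fps _ => h * fps_quot fpsT h)).
  move/(congr1 (fun h : fps {poly F} => h 1%N)).
  rewrite mul0r mulrC bernoulli2_quotK //=; exact/eqP/oner_neq0.
rewrite -fps_comp_1DTV // -fps_comp_1DT -fps_compB -fps_compM //.
by rewrite daehee2_quotK // fps_comp_log1p.
Qed.

(** The Stirling numbers live in [F] and the generating functions over [{poly F}]; embedding
    constants maps [e^t - 1] to itself. *)
Lemma stirling2_polyC n l : (stirling2 F n l)%:P =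
  egf_coef (fps_expm1 {poly F} ^+ l) n / l`!%:R.
Proof.
have mapE : fps_map (@polyC F) (fps_expm1 F) = fps_expm1 {poly F}.
  rewrite fps_mapB fps_map1; congr (_ - _); apply: fpsP => i /=.
  by rewrite !expr1n !mul1r -polyCV -polyC_natr.
have VfactE : (l`!%:R : fps F)^-1 = fpsC (l`!%:R^-1).
  rewrite rmorphV ?rmorph_nat // unitfE ((pcharf0P F).1 charF0).
  by rewrite -lt0n fact_gt0.
rewrite /stirling2 /egf_coef VfactE [_ * fpsC _]mulrC coef_fpsCM -mapE -fps_mapX /=.
by rewrite !polyCM -polyCV !polyC_natr mulrCA mulrC.
Qed.

Lemma bernoulli2_poly_stirling2 n : bernoulli2_poly F n =
  \sum_(l < n.+1) stirling2 F n l *: daehee2_poly F l.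
Proof.
rewrite /bernoulli2_poly -daehee2_gf_comp /egf_coef coef_fps_comp mulr_sumr.
apply: eq_bigr => l _; rewrite -mul_polyC stirling2_polyC /daehee2_poly /egf_coef.
(* The [l!] dividing the Stirling number cancels the one in [d_l(x)]. *)
rewrite -[RHS]mulrA mulKr ?fact_polyF_unit //.
by rewrite mulrAC mulrA.
Qed.

End Families.

Theorem theorem4 (F : fieldType) (charF0 : [pchar F] =i pred0) (n : nat) :
  bernoulli2_poly F n = \sum_(l < n.+1) stirling2 F n l *: daehee2_poly F l
  /\ bernoulli2 F n = \sum_(l < n.+1) stirling2 F n l * daehee2 F l.
Proof.
split; first exact: bernoulli2_poly_stirling2.
rewrite /bernoulli2 bernoulli2_poly_stirling2 // horner_sum.
by apply: eq_bigr => l _; rewrite hornerZ.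
Qed.
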